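(* Let $N\in\mathbb N$ and, for each $t$, let $(\tilde x_0,\dots,\tilde x_d)=(x_0,\dots,x_d)Q(t)$ and $\tilde x^\rho=\tilde x_0^{\rho_0}\cdots\tilde x_d^{\rho_d}$ for $\rho\in\mathbb N^{d+1}$ with $|\rho|=N$. The eigenvectors of $L(t)$ in $\mathbb C_N[x]$ are the polynomials $\tilde x^\rho$, $|\rho|=N$ (i.e. these form a basis of $\mathbb C_N[x]$ of eigenvectors of $L(t)$), and they are given by $$\tilde x^\rho=\prod_{i=0}^d\big(w_i(t)\big)^{\frac12\rho_i}\sum_{|\sigma|=N}\binom N\sigma P(\sigma',\rho')\,x^\sigma,$$ where $P$ is defined with $u_{i,j}=\frac{Q(t)_{j,i}}{Q(t)_{0,i}}=p_j(\lambda_i;t)$, $0\le i\le d$, $1\le j\le d$. Moreover $$L(t)\,\tilde x^\rho=\Big(\sum_{i=0}^d\lambda_i\rho_i\Big)\tilde x^\rho.$$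
   Context: $\mathbb N=\{0,1,2,\dots\}$, $d\ge1$. Let $E_{i,j}$, $i,j\in\{0,\dots,d\}$, be the matrix units of $\mathfrak{gl}(d+1,\mathbb C)$ and $H_i=E_{i-1,i-1}-E_{i,i}$. Let $r_i,s_i$ be real-valued $C^1$ functions and $u_i$ real-valued continuous functions of $t$ ($1\le i\le d$), with $r_i>0$, $u_i$ nowhere zero, $\frac{r_{i-1}}{r_i}=\frac{u_{i-1}}{u_i}$ for $2\le i\le d$, and $$L(t)=\sum_{i=1}^ds_i(t)H_i+\sum_{i=1}^dr_i(t)(E_{i-1,i}+E_{i,i-1}),\qquad M(t)=\sum_{i=1}^du_i(t)(E_{i-1,i}-E_{i,i-1}),$$ satisfying the Lax equation $\dot L(t)=[M(t),L(t)]$. Put $s_0=s_{d+1}=0$. Polynomials $p_n(\lambda;t)$, $0\le n\le d$, of degree $n$ in $\lambda$ are defined by $p_0=1$, $\lambda p_0=r_1p_1+s_1p_0$, and $\lambda p_n=r_{n+1}p_{n+1}+(s_{n+1}-s_n)p_n+r_np_{n-1}$ for $1\le n<d$. The numbers $\lambda_0,\dots,\lambda_d$ are the $d+1$ distinct real zeros of $\lambda p_d(\lambda;t)+s_d(t)p_d(\lambda;t)-r_d(t)p_{d-1}(\lambda;t)$; they do not depend on $t$ and are the eigenvalues of the matrix $L(t)$. Set $w_r(t)=\big(\sum_{n=0}^dp_n(\lambda_r;t)^2\big)^{-1}>0$ and let $Q(t)=\big(p_i(\lambda_j;t)\sqrt{w_j(t)}\big)_{i,j=0}^d$, a real orthogonal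 matrix. $\mathbb C_N[x]=\mathbb C_N[x_0,\dots,x_d]$ is the space of homogeneous polynomials of degree $N$, on which $\mathfrak{gl}(d+1,\mathbb C)$ acts by $E_{i,j}\mapsto x_i\frac{\partial}{\partial x_j}$; ''$L(t)$ in $\mathbb C_N[x]$'' means the image of $L(t)$ under this action. For $\rho\in\mathbb N^{d+1}$: $|\rho|=\sum_i\rho_i$, $x^\rho=\prod x_i^{\rho_i}$, $\binom N\rho=\frac{N!}{\rho_0!\cdots\rho_d!}$, $\rho'=(\rho_1,\dots,\rho_d)$. Multivariable Krawtchouk polynomials: given numbers $u_{i,j}$ ($0\le i\le d$, $1\le j\le d$), $P(\sigma',\rho')$ for $|\sigma|=|\rho|=N$ is defined by the generating function $$\prod_{i=0}^d\Big(z_0+\sum_{j=1}^du_{i,j}z_j\Big)^{\rho_i}=\sum_{|\sigma|=N}\binom N\sigma P(\sigma',\rho')\,z_0^{\sigma_0}\cdots z_d^{\sigma_d}.$$ (The numbers $u_{i,j}$ are not to be confused with the functions $u_i(t)$.) *)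

(* Defs.v *)
From HB Require Import structures.
From mathcomp Require Import all_boot all_order all_algebra.
From mathcomp Require Import -(notations) mpoly.
From mathcomp Require Import complex.
From mathcomp Require Import all_classical all_reals.
From mathcomp Require Import topology normedtype derive exp.

Set Implicit Arguments.
Unset Strict Implicit.
Unset Printing Implicit Defensive.

Import Order.TTheory GRing.Theory Num.Theory.
Import numFieldNormedType.Exports.

Local Open Scope classical_set_scope.
Local Open Scope ring_scope.
Local Open Scope complex_scope.

Section LaxPair.
Variables (R : realType) (d : nat).

(* The time domain is an open set of R, so no one-sided derivatives occur. *)
Definition C1_on (T : set R) (f : R -> R) : Prop :=
  forall t, T t -> derivable f t 1 /\ {for t, continuous (derive1 f)}.

Definition C0_on (T : set R) (f : R -> R) : Prop :=
  forall t, T t -> {for t, continuous f}.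

(* Families (r_i), (s_i), (u_i) with 1 <= i <= d are indexed by nat; their
   values at the other indices are never used. *)
Implicit Types (r s u : nat -> R -> R).

Definition E (i j : nat) : 'M[R]_d.+1 := delta_mx (inord i) (inord j).

Definition H (i : nat) : 'M[R]_d.+1 := E i.-1 i.-1 - E i i.

Definition Lmx r s (t : R) : 'M[R]_d.+1 :=
  \sum_(1 <= i < d.+1) s i t *: H i
  + \sum_(1 <= i < d.+1) r i t *: (E i.-1 i + E i i.-1).

Definition Mmx u (t : R) : 'M[R]_d.+1 :=
  \sum_(1 <= i < d.+1) u i t *: (E i.-1 i - E i i.-1).

(* p_n(.; t), obtained by solving the three-term recurrence for p_{n+1};
   see ppoly_rec0 and ppoly_recS. *)
Fixpoint ppoly r s (t : R) (n : nat) : {poly R} :=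
  match n with
  | 0 => 1
  | m.+1 =>
    match m with
    | 0 => (r 1%N t)^-1 *: ('X - (s 1%N t)%:P)
    | k.+1 => (r n t)^-1 *: (('X - (s n t - s m t)%:P) * ppoly r s t m
                             - r m t *: ppoly r s t k)
    end
  end.

Lemma ppoly_rec0 r s t : r 1%N t != 0 ->
  'X * ppoly r s t 0 = r 1%N t *: ppoly r s t 1 + s 1%N t *: ppoly r s t 0.
Proof.
by move=> r0 /=; rewrite scalerA divff // scale1r mulr1 alg_polyC subrK.
Qed.

Lemma ppoly_recS r s t n : (0 < n)%N -> r n.+1 t != 0 ->
  'X * ppoly r s t n = r n.+1 t *: ppoly r s t n.+1
    + (s n.+1 t - s n t) *: ppoly r s t n + r n t *: ppoly r s t n.-1.
Proof.
case: n => // n _ r0; rewrite [ppoly r s t n.+2]/=.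
rewrite scalerA divff // scale1r mulrBl mul_polyC /=.
by rewrite addrAC subrK subrK.
Qed.

Definition zpoly r s (t : R) : {poly R} :=
  'X * ppoly r s t d + s d t *: ppoly r s t d - r d t *: ppoly r s t d.-1.

Definition wgt r s (lam : 'I_d.+1 -> R) (t : R) (j : 'I_d.+1) : R :=
  (\sum_(n < d.+1) (ppoly r s t n).[lam j] ^+ 2)^-1.

Definition Qmx r s (lam : 'I_d.+1 -> R) (t : R) : 'M[R]_d.+1 :=
  \matrix_(i, j) ((ppoly r s t i).[lam j] * Num.sqrt (wgt r s lam t j)).

End LaxPair.

Section Action.
Variables (C : comNzRingType) (d : nat).

(* E_{i,j} acts as x_i d/dx_j *)
Definition glact (A : 'M[C]_d.+1) (p : mpoly d.+1 C) : mpoly d.+1 C :=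
  \sum_(i < d.+1) \sum_(j < d.+1) A i j *: (mpolyX C (mnm1 i) * mderiv j p).

Definition xtilde (Q : 'M[C]_d.+1) : 'rV[mpoly d.+1 C]_d.+1 :=
  (\row_i mpolyX C (mnm1 i)) *m map_mx (@mpolyC d.+1 C) Q.

Definition xtilde_mon (Q : 'M[C]_d.+1) (rho : multinom d.+1) : mpoly d.+1 C :=
  \prod_(i < d.+1) xtilde Q ord0 i ^+ rho i.

End Action.

Section Krawtchouk.
Variables (C : numFieldType) (d : nat).

Definition mnm_tail (rho : multinom d.+1) : multinom d :=
  Multinom [tuple rho (lift ord0 i) | i < d].

(* The rho with |rho| = N and mnm_tail rho = rho', for |rho'| <= N. *)
Definition mnm_complete (N : nat) (rho' : multinom d) : multinom d.+1 :=
  Multinom [tuple oapp rho' (N - mdeg rho')%N (unlift ord0 i) | i < d.+1].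

Definition multinomial (sigma : multinom d.+1) : C :=
  ((mdeg sigma)`!)%:R / (\prod_(i < d.+1) (sigma i)`!)%:R.

(* The column index j : 'I_d of U stands for the index j + 1 in {1,...,d}. *)
Definition krawtchouk_gf (U : 'M[C]_(d.+1, d)) (rho : multinom d.+1) :
    mpoly d.+1 C :=
  \prod_(i < d.+1) (mpolyX C (mnm1 ord0)
     + \sum_(j < d) U i j *: mpolyX C (mnm1 (lift ord0 j))) ^+ rho i.

(* P(sigma', rho'), read off from the generating function; see
   krawtchouk_gfE. *)
Definition krawtchouk (N : nat) (U : 'M[C]_(d.+1, d))
    (sigma' rho' : multinom d) : C :=
  mcoeff (mnm_complete N sigma') (krawtchouk_gf U (mnm_complete N rho'))
    / multinomial (mnm_complete N sigma').

Lemma mnm_tailK (rho : multinom d.+1) :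
  mnm_complete (mdeg rho) (mnm_tail rho) = rho.
Proof.
apply/mnmP => i; rewrite mnmE.
case: unliftP => [j ->|->] /=; first by rewrite mnmE.
rewrite !mdegE big_ord_recl.
have -> : (\sum_(i0 < d) mnm_tail rho i0 = \sum_(i0 < d) rho (lift ord0 i0))%N.
  by apply: eq_bigr => j _; rewrite mnmE.
by rewrite addnK.
Qed.

Lemma multinomial_neq0 (sigma : multinom d.+1) : multinomial sigma != 0.
Proof.
rewrite mulf_neq0 ?invr_eq0 ?pnatr_eq0 -?lt0n ?fact_gt0 //.
by apply: prodn_gt0 => i; rewrite fact_gt0.
Qed.

Lemma krawtchouk_gf_homog (U : 'M[C]_(d.+1, d)) (rho : multinom d.+1) :
  krawtchouk_gf U rho \is @ishomog1 d.+1 C (mdeg rho) mdeg.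
Proof.
have lin i : (mpolyX C (mnm1 ord0) + \sum_(j < d) U i j
    *: mpolyX C (mnm1 (lift ord0 j))) \is @ishomog1 d.+1 C 1 mdeg.
  apply: rpredD; first by rewrite dhomogX; apply/eqP; apply: mdeg1.
  apply: rpred_sum => j _; apply: rpredZ.
  by rewrite dhomogX; apply/eqP; apply: mdeg1.
rewrite mdegE /krawtchouk_gf.
apply: (big_ind2 (fun (p : mpoly d.+1 C) k => p \is @ishomog1 d.+1 C k mdeg)).
- exact: dhomog1.
- by move=> p k q l hp hq; apply: dhomogM.
- by move=> i _; rewrite -[X in ishomog1 X _]mul1n; apply: dhomogMn; apply: lin.
Qed.

Lemma krawtchouk_gfE (N : nat) (U : 'M[C]_(d.+1, d)) (rho : multinom d.+1) :
  mdeg rho = N ->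
  krawtchouk_gf U rho =
    \sum_(sigma : bmultinom d.+1 N.+1 | mdeg sigma == N)
      (multinomial sigma * krawtchouk N U (mnm_tail sigma) (mnm_tail rho))
        *: mpolyX C sigma.
Proof.
move=> <-.
have hom := krawtchouk_gf_homog U rho.
rewrite [LHS](mpolywE (k := (mdeg rho).+1)); last first.
  rewrite mmeasureE; apply/bigmax_leqP_seq => m hm _.
  by rewrite ltnS; have /dhomogP/(_ m hm) -> := hom.
rewrite [RHS]big_mkcond /=; apply: eq_bigr => m _.
case: eqP => [mN|/eqP mN]; last by rewrite (dhomog_nemf_coeff hom mN) scale0r.
have cm := mnm_tailK m; rewrite mN in cm.
congr (_ *: _); rewrite /krawtchouk cm mnm_tailK.
by rewrite mulrC -mulrA mulVf ?mulr1 // multinomial_neq0.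
Qed.

End Krawtchouk.

(* Main.v *)
(* The three-term recurrence and the vanishing of zpoly at lambda_j say that
   the columns of Q are eigenvectors of the symmetric matrix L, so Q is
   orthogonal and L Q = Q diag(lambda).  The gl(d+1)-action is by derivations
   and sends the linear form (x B)_j to (x L B)_j; hence each xtilde_j, and then
   each monomial in them, is an eigenvector.  The linear substitution
   x -> x Q is invertible, so it maps the monomial basis to a basis.  Dividing
   xtilde_i by its x_0-coefficient Q_{0,i} = sqrt(w_i) turns the monomial into
   the generating function of the Krawtchouk polynomials. *)

Require Import Defs.
From mathcomp Require Import all_boot all_order all_algebra.
From mathcomp Require Import -(notations) mpoly.
From mathcomp Require Import complex.
From mathcomp Require Import all_classical all_reals.
From mathcomp Require Import topology normedtype derive exp.
From mathcomp Require Import ring.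

Set Implicit Arguments.
Unset Strict Implicit.
Unset Printing Implicit Defensive.

Import Order.TTheory GRing.Theory Num.Theory.
Import numFieldNormedType.Exports.

Local Open Scope classical_set_scope.
Local Open Scope ring_scope.
Local Open Scope complex_scope.

(** * Linear substitutions in polynomials *)

Section LinearSubstitution.
Variables (C : comNzRingType) (d : nat).
Implicit Types (A B : 'M[C]_d.+1) (p q : mpoly d.+1 C) (rho : multinom d.+1).

Definition xsubst A : d.+1.-tuple (mpoly d.+1 C) :=
  [tuple xtilde A ord0 i | i < d.+1].

Lemma xtildeE A i :
  xtilde A ord0 i = \sum_(k < d.+1) A k i *: mpolyX C (mnm1 k).
Proof. by rewrite mxE; apply: eq_bigr => k _; rewrite !mxE mulrC mul_mpolyC. Qed.

Lemma xtilde_monE A rho :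
  xtilde_mon A rho = comp_mpoly (xsubst A) (mpolyX C rho).
Proof.
by rewrite comp_mpolyX; apply: eq_bigr => i _; rewrite tnth_mktuple.
Qed.

(** Replacing $x$ by $xA$ in $xB$ gives $(xA)B = x(AB)$, so composing substitutions amounts to
    multiplying matrices. *)
Lemma comp_xtilde A B i :
  comp_mpoly (xsubst A) (xtilde B ord0 i) = xtilde (A *m B) ord0 i.
Proof.
rewrite xtildeE raddf_sum /= xtildeE.
under eq_bigr => k _.
  rewrite comp_mpolyZ comp_mpolyXU -tnth_nth tnth_mktuple xtildeE scaler_sumr.
  over.
rewrite exchange_big; apply: eq_bigr => k _ /=.
rewrite mxE scaler_suml; apply: eq_bigr => l _.
by rewrite scalerA mulrC.
Qed.

Lemma xtilde1 i : xtilde (1%:M : 'M[C]_d.+1) ord0 i = mpolyX C (mnm1 i).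
Proof.
rewrite xtildeE (bigD1 i) //= mxE eqxx scale1r big1 ?addr0 // => k /negPf ki.
by rewrite mxE ki scale0r.
Qed.

Lemma comp_xsubstE A p : comp_mpoly (xsubst A) p =
  \sum_(m <- msupp p) mcoeff m p *: xtilde_mon A m.
Proof.
rewrite comp_mpolyEX; apply: eq_bigr => m _.
by rewrite xtilde_monE comp_mpolyX.
Qed.

Lemma comp_xtilde_mon A B rho : A *m B = 1%:M ->
  comp_mpoly (xsubst A) (xtilde_mon B rho) = mpolyX C rho.
Proof.
move=> AB; rewrite rmorph_prod mpolyXE_id; apply: eq_bigr => i _.
by rewrite rmorphXn /= comp_xtilde AB xtilde1.
Qed.

(** By linearity it is enough to follow monomials: $x^\rho$ goes to $(xB)^\rho$, then to $(xAB)^\rho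
    = x^\rho$. *)
Lemma comp_xsubstK A B : A *m B = 1%:M ->
  cancel (comp_mpoly (xsubst B)) (comp_mpoly (xsubst A)).
Proof.
move=> AB p; rewrite [comp_mpoly (xsubst B) p]comp_xsubstE.
move: (linear_sum (comp_mpoly (xsubst A))) => /= ->.
rewrite [RHS]mpolyE; apply: eq_bigr => m _.
by rewrite comp_mpolyZ comp_xtilde_mon.
Qed.

Lemma xtilde_homog A i : xtilde A ord0 i \is @ishomog1 d.+1 C 1 mdeg.
Proof.
rewrite xtildeE; apply: rpred_sum => k _; apply: rpredZ.
by rewrite dhomogX; apply/eqP; apply: mdeg1.
Qed.

Lemma xtilde_mon_homog A rho N : mdeg rho = N ->
  xtilde_mon A rho \is @ishomog1 d.+1 C N mdeg.
Proof.
move=> <-; rewrite mdegE.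
apply: (big_ind2 (fun p k => p \is @ishomog1 d.+1 C k mdeg)).
- exact: dhomog1.
- by move=> p k q l hp hq; apply: dhomogM.
- by move=> i _; rewrite -[X in ishomog1 X _]mul1n; apply/dhomogMn/xtilde_homog.
Qed.

Lemma comp_xsubst_homog A p N : p \is @ishomog1 d.+1 C N mdeg ->
  comp_mpoly (xsubst A) p \is @ishomog1 d.+1 C N mdeg.
Proof.
move=> /dhomogP hp; rewrite comp_xsubstE big_seq; apply: rpred_sum.
by move=> m /hp mN; apply/rpredZ/xtilde_mon_homog.
Qed.

Lemma dhomog_mpolyE p N : p \is @ishomog1 d.+1 C N mdeg ->
  p = \sum_(m : bmultinom d.+1 N.+1 | mdeg m == N)
        mcoeff m p *: mpolyX C m.
Proof.
move=> hom; rewrite {1}[p](mpolywE (k := N.+1)); last first.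
  rewrite mmeasureE; apply/bigmax_leqP_seq => m hm _.
  by rewrite ltnS; have /dhomogP/(_ m hm) -> := hom.
rewrite [RHS]big_mkcond /=; apply: eq_bigr => m _.
by case: eqP => [//|/eqP mN]; rewrite (dhomog_nemf_coeff hom mN) scale0r.
Qed.

Lemma comp_xsubst_homogE A p N : p \is @ishomog1 d.+1 C N mdeg ->
  comp_mpoly (xsubst A) p =
    \sum_(m : bmultinom d.+1 N.+1 | mdeg m == N)
      mcoeff m p *: xtilde_mon A m.
Proof.
move=> /dhomog_mpolyE {1}->.
move: (linear_sum (comp_mpoly (xsubst A))) => /= ->.
by apply: eq_bigr => m _; rewrite comp_mpolyZ -xtilde_monE.
Qed.

Lemma indhomogK p N : p \is @ishomog1 d.+1 C N mdeg ->
  val (indhomog N p) = p.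
Proof. exact: insubdK. Qed.

End LinearSubstitution.

(** * A basis of the homogeneous polynomials *)

Lemma card_homog_bmultinom d N :
  #|[pred m : bmultinom d.+1 N.+1 | mdeg (val m) == N]| = 'C(N + d, N).
Proof.
(* [basis d N] lists the exponents of degree [N] without repetition; the count is the dimension of
   the homogeneous space. *)
rewrite -(size_basis d N) cardE -(size_map val); apply: perm_size.
apply: uniq_perm; first by rewrite (map_inj_uniq val_inj) enum_uniq.
  exact: uniq_basis.
move=> m; rewrite -basis_cover; apply/mapP/eqP => [[b]|mN].
  by rewrite mem_enum inE => /eqP bN ->.
have mlt : (mdeg m < N.+1)%N by rewrite mN.
by exists (BMultinom mlt); rewrite // mem_enum inE /= mN.
Qed.

(** The family has as many members as the dimension, so only spanning has to be shown. *)
Lemma xtilde_mon_basis (F : fieldType) d N (A B : 'M[F]_d.+1) :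
  A *m B = 1%:M ->
  basis_of fullv
    [seq indhomog N (xtilde_mon A (val rho))
      | rho : bmultinom d.+1 N.+1 in [pred rho | mdeg (val rho) == N]].
Proof.
move=> AB; rewrite basisEdim size_map -cardE card_homog_bmultinom.
rewrite dimvf leqnn andbT; apply/subvP => p _.
have hp := dhomog_is_dhomog p.
(* The coordinates of $p(x)$ are the coefficients of $p(xB)$: substituting $xA$ for $x$ there gives
   back $p$. *)
have -> : p = \sum_(m : bmultinom d.+1 N.+1 | mdeg m == N)
    mcoeff m (comp_mpoly (xsubst B) (val p)) *: indhomog N (xtilde_mon A m).
  apply: val_inj; rewrite raddf_sum -[LHS](comp_xsubstK AB).
  rewrite (comp_xsubst_homogE _ (comp_xsubst_homog B hp)).
  apply: eq_bigr => m /eqP mN; congr (_ *: _).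
  by rewrite indhomogK //; apply: xtilde_mon_homog.
apply: rpred_sum => m mN; apply: rpredZ; apply: memv_span.
by apply/mapP; exists m => //; rewrite mem_enum inE.
Qed.

(** * The action of $\mathfrak{gl}(d+1)$ by derivations *)

Section GlAction.
Variables (C : comNzRingType) (d : nat) (A : 'M[C]_d.+1).
Implicit Types (p q : mpoly d.+1 C).

Lemma glactM p q : glact A (p * q) = glact A p * q + p * glact A q.
Proof.
rewrite /glact mulr_suml mulr_sumr -big_split; apply: eq_bigr => i _ /=.
rewrite mulr_suml mulr_sumr -big_split; apply: eq_bigr => j _ /=.
by rewrite mderivM mulrDr scalerDr -scalerAl -scalerAr !mulrA [p * _]mulrC.
Qed.

Lemma glact1 : glact A 1 = 0.
Proof.
rewrite /glact big1 // => i _; rewrite big1 // => j _.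
by rewrite -mpolyC1 mderivC mulr0 scaler0.
Qed.

Lemma glactX (c : C) n p : glact A p = c *: p ->
  glact A (p ^+ n) = (c * n%:R) *: p ^+ n.
Proof.
move=> Ap; elim: n => [|n IHn]; first by rewrite expr0 glact1 mulr0 scale0r.
rewrite exprS glactM Ap IHn -scalerAl -scalerAr -scalerDl.
by rewrite -[n.+1]add1n natrD mulrDr mulr1.
Qed.

(** $\partial_l (xB)_i$ is the constant $B_{l,i}$, so the coefficient of $x_k$ becomes $\sum_l
    A_{k,l}B_{l,i}$. *)
Lemma glact_xtilde (B : 'M[C]_d.+1) i :
  glact A (xtilde B ord0 i) = xtilde (A *m B) ord0 i.
Proof.
rewrite [RHS]xtildeE; apply: eq_bigr => k _.
rewrite [(A *m B) k i]mxE scaler_suml; apply: eq_bigr => l _.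
have -> : mderiv l (xtilde B ord0 i) = mpolyC _ (B l i).
  rewrite xtildeE raddf_sum (bigD1 l) //= big1 ?addr0 => [|j /negPf jl].
    rewrite mderivZ mderivX mnm1E eqxx scale1r -{1}[mnm1 l]add0m addmK mpolyX0.
    by rewrite -mul_mpolyC mulr1.
  by rewrite mderivZ mderivX mnm1E jl scale0r scaler0.
by rewrite mulrC mul_mpolyC scalerA.
Qed.

Lemma glact_xtilde_mon (B : 'M[C]_d.+1) (lam : 'rV[C]_d.+1) rho :
  A *m B = B *m diag_mx lam ->
  glact A (xtilde_mon B rho)
  = (\sum_i lam ord0 i * (rho i)%:R) *: xtilde_mon B rho.
Proof.
move=> AB; apply: (big_ind2 (fun p c => glact A p = c *: p)).
- by rewrite glact1 scale0r.
- by move=> p a q b pa qb; rewrite glactM pa qb -scalerAl -scalerAr -scalerDl.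
move=> i _; apply: glactX; rewrite glact_xtilde AB !xtildeE scaler_sumr.
by apply: eq_bigr => k _; rewrite mul_mx_diag mxE mulrC scalerA.
Qed.

End GlAction.

(** * The tridiagonal matrix $L$ and its eigenvectors *)

Section Jacobi.
Variables (R : realType) (d : nat) (r s : nat -> R -> R) (t : R).

Lemma eq_inord (a : nat) (i : 'I_d.+1) : (a <= d)%N ->
  (i == inord a) = (a == i :> nat).
Proof. by move=> ad; rewrite -val_eqE /= inordK // eq_sym. Qed.

Lemma Lmx_entry (i j : 'I_d.+1) : Lmx d r s t i j =
  \sum_(1 <= k < d.+1) (s k t * (((k.-1 == i) && (k.-1 == j))%:R
                                 - ((k == i) && (k == j))%:R)
    + r k t * (((k.-1 == i) && (k == j))%:R + ((k == i) && (k.-1 == j))%:R)).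
Proof.
rewrite /Lmx -big_split summxE; apply: eq_big_nat => k /andP[k0 kd].
have k1d : (k.-1 <= d)%N by rewrite (leq_trans (leq_pred k)).
by rewrite !mxE !eq_inord.
Qed.

Lemma Lmx_sym : (Lmx d r s t)^T = Lmx d r s t.
Proof.
apply/matrixP => i j; rewrite mxE !Lmx_entry; apply: eq_bigr => k _.
by rewrite !(andbC (_ == nat_of_ord j)) [in X in _ + _ * X]addrC.
Qed.

Lemma sum_nat_delta (m n i : nat) (g : nat -> R) :
  \sum_(m <= k < n) (k == i)%:R * g k = if (m <= i < n)%N then g i else 0.
Proof.
rewrite -(@big_nat1_eq _ 0 +%R) [RHS]big_mkcond /=; apply: eq_bigr => k _.
by case: eqP => [->|_]; rewrite ?mul1r ?mul0r.
Qed.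

(** Row [i] receives contributions only from the summands [k = i.+1] and [k = i] of $L$. The two
    conditionals drop the one missing at each end, which matches $s_0 = s_{d+1} = 0$. *)
Lemma Lmx_mulE (f : nat -> R) (i : 'I_d.+1) :
  \sum_(j < d.+1) Lmx d r s t i j * f j =
  (if (i < d)%N then s i.+1 t * f i + r i.+1 t * f i.+1 else 0)
  + (if (0 < i)%N then r i t * f i.-1 - s i t * f i else 0).
Proof.
have delta a b : (b <= d)%N ->
    \sum_(j < d.+1) ((a == i :> nat) && (b == j :> nat))%:R * f j
    = (a == i :> nat)%:R * f b.
  move=> bd; case: (a == i :> nat); last first.
    by rewrite mul0r big1 // => j _; rewrite mul0r.
  rewrite (bigD1 (inord b)) //= inordK // eqxx big1 ?addr0 // => j jb.
  case: eqP => [bj|_]; last by rewrite mul0r.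
  by rewrite bj inord_val eqxx in jb.
under eq_bigr => j _ do rewrite Lmx_entry mulr_suml.
rewrite exchange_big /=.
(* The terms are grouped by the row they land in, [k.-1] or [k]. *)
transitivity (\sum_(1 <= k < d.+1)
    ((k.-1 == i)%:R * (s k t * f k.-1 + r k t * f k)
     + (k == i)%:R * (r k t * f k.-1 - s k t * f k))).
  apply: eq_big_nat => k /andP[k0 kd].
  have k1d : (k.-1 <= d)%N by rewrite (leq_trans (leq_pred k)).
  transitivity (s k t * ((k.-1 == i)%:R * f k.-1 - (k == i)%:R * f k)
    + r k t * ((k.-1 == i)%:R * f k + (k == i)%:R * f k.-1)); last by ring.
  rewrite -!delta // -sumrB -big_split !mulr_sumr -big_split.
  by apply: eq_bigr => j _ /=; ring.
rewrite big_split /=; congr (_ + _); last by rewrite sum_nat_delta ltn_ord andbT.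
by rewrite big_add1 /= sum_nat_delta.
Qed.

Hypothesis d_gt0 : (0 < d)%N.
Hypothesis r_neq0 : forall i, (1 <= i <= d)%N -> r i t != 0.

Lemma Lmx_eigen (x : R) (i : 'I_d.+1) : root (zpoly d r s t) x ->
  \sum_(j < d.+1) Lmx d r s t i j * (ppoly r s t j).[x]
  = x * (ppoly r s t i).[x].
Proof.
pose f n := (ppoly r s t n).[x]; rewrite -/(f i).
(* [!hornerZ] would also unfold [ppoly] at successors and split it. *)
have hornerDZ (p q : {poly R}) a : (a *: p + q).[x] = a * p.[x] + q.[x].
  by rewrite hornerD hornerZ.
have rec0 : x * f 0%N = r 1%N t * f 1%N + s 1%N t * f 0%N.
  transitivity ('X * ppoly r s t 0).[x]; first by rewrite hornerM hornerX.
  by rewrite ppoly_rec0 ?r_neq0 // hornerDZ (hornerZ (s _ _)).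
have recS n : (n.+1 < d)%N -> x * f n.+1
    = r n.+2 t * f n.+2 + (s n.+2 t - s n.+1 t) * f n.+1 + r n.+1 t * f n.
  move=> nd; transitivity ('X * ppoly r s t n.+1).[x].
    by rewrite hornerM hornerX.
  by rewrite ppoly_recS ?r_neq0 // -addrA !hornerDZ (hornerZ (r n.+1 t)) addrA.
move=> /rootP; rewrite /zpoly hornerD hornerN hornerD hornerM hornerX !hornerZ.
rewrite -/(f d) -/(f d.-1) (Lmx_mulE f) => zx.
(* The last row is the equation [zpoly] $= 0$ at [x]; every other row is the recurrence at [x]. *)
have [id|di] := ltnP i d; last first.
  have -> : i = d :> nat by apply/eqP; rewrite eqn_leq di -ltnS ltn_ord.
  by rewrite d_gt0 add0r; apply/esym/eqP; rewrite -subr_eq0 -zx; apply/eqP; ring.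
case: i id => [[|n] ni] /= nd; first by rewrite rec0 addr0 addrC.
by rewrite recS //; ring.
Qed.

Variable lam : 'I_d.+1 -> R.

(** The term $p_0^2 = 1$ keeps the sum of squares positive. *)
Lemma wgt_gt0 j : 0 < wgt r s lam t j.
Proof.
rewrite invr_gt0 (bigD1 ord0) //= hornerC expr1n ltr_wpDr //.
by apply: sumr_ge0 => i _; rewrite sqr_ge0.
Qed.

Lemma Qmx_row0 j : Qmx r s lam t ord0 j = Num.sqrt (wgt r s lam t j).
Proof. by rewrite mxE /= hornerC mul1r. Qed.

Lemma Qmx_row0_neq0 j : Qmx r s lam t ord0 j != 0.
Proof. by rewrite Qmx_row0 sqrtr_eq0 -ltNge wgt_gt0. Qed.

Lemma Qmx_ratio i j :
  Qmx r s lam t i j / Qmx r s lam t ord0 j = (ppoly r s t i).[lam j].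
Proof.
have := Qmx_row0_neq0 j; rewrite Qmx_row0 => w0.
by rewrite mxE mulfK.
Qed.

Hypothesis lam_zero : forall j, root (zpoly d r s t) (lam j).

Lemma Lmx_Qmx : Lmx d r s t *m Qmx r s lam t
  = Qmx r s lam t *m diag_mx (\row_j lam j).
Proof.
apply/matrixP => i j; rewrite mul_mx_diag !mxE.
under eq_bigr => k _ do rewrite [Qmx _ _ _ _ k j]mxE mulrA.
by rewrite -mulr_suml Lmx_eigen //; ring.
Qed.

Hypothesis lam_inj : injective lam.

(* Eigenvectors of the symmetric matrix L for distinct eigenvalues are
   orthogonal: D (Q^T Q) = (Q^T Q) D with D diagonal with distinct entries. *)
Lemma Qmx_orthogonal : Qmx r s lam t *m (Qmx r s lam t)^T = 1%:M.
Proof.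
apply: mulmx1C; set Q := Qmx r s lam t; set G := Q^T *m Q.
pose D := diag_mx (\row_j lam j).
(* Both sides equal $Q^T L Q$, by $LQ = QD$ and its transpose. *)
have DG : D *m G = G *m D.
  rewrite /G mulmxA -[D in LHS]tr_diag_mx -trmx_mul -Lmx_Qmx trmx_mul Lmx_sym.
  by rewrite -!mulmxA Lmx_Qmx.
apply/matrixP => i j; rewrite [RHS]mxE; have [<-|ij] := eqVneq i j; last first.
  move/matrixP/(_ i j): DG; rewrite mul_diag_mx mul_mx_diag !mxE => /eqP.
  rewrite mulrC -subr_eq0 -mulrBr mulf_eq0 subr_eq0 (inj_eq lam_inj).
  by rewrite (negPf ij) orbF => /eqP.
(* On the diagonal the sum is $w_i\sum_k p_k(\lambda_i)^2$, which is 1 by the choice of the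
   weight. *)
rewrite mxE; under eq_bigr => k _.
  rewrite !mxE mulrACA -!expr2 sqr_sqrtr ?(ltW (wgt_gt0 _)) //.
  over.
rewrite -mulr_suml mulfV // -invr_eq0.
by rewrite gt_eqF ?wgt_gt0.
Qed.

End Jacobi.

(** * Krawtchouk expansion and the eigenbasis *)

Lemma xtilde_mon_krawtchouk_gf (F : numFieldType) d (Q : 'M[F]_d.+1) rho :
  (forall i, Q ord0 i != 0) ->
  xtilde_mon Q rho = (\prod_(i < d.+1) Q ord0 i ^+ rho i)
    *: krawtchouk_gf (\matrix_(i, j) (Q (lift ord0 j) i / Q ord0 i)) rho.
Proof.
move=> Q0; rewrite -scaler_prod; apply: eq_bigr => i _.
(* The $x_0$ term is split off, since the generating function gives $z_0$ the coefficient 1. *)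
rewrite -exprZn xtildeE big_ord_recl scalerDr scaler_sumr.
congr ((_ + _) ^+ _); apply: eq_bigr => j _.
by rewrite mxE scalerA mulrC divfK.
Qed.

(** Links the square roots in [Qmx] to the half-integer powers of the weights in the expansion. *)
Lemma sqrtrX_powR (R : realType) (x : R) n : 0 < x ->
  Num.sqrt x ^+ n = x `^ (n%:R / 2).
Proof.
by move=> x0; rewrite mulrC powRrM powR12_sqrt ?ltW // powR_mulrn ?sqrtr_ge0.
Qed.

Theorem lemma8p5 (R : realType) (d N : nat) (d_gt0 : (0 < d)%N)
    (T : set R) (T_open : open T) (T_itv : is_interval T)
    (r s u : nat -> R -> R)
    (r_C1 : forall i, (1 <= i <= d)%N -> C1_on T (r i))
    (s_C1 : forall i, (1 <= i <= d)%N -> C1_on T (s i))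
    (u_C0 : forall i, (1 <= i <= d)%N -> C0_on T (u i))
    (r_gt0 : forall i t, (1 <= i <= d)%N -> T t -> 0 < r i t)
    (u_neq0 : forall i t, (1 <= i <= d)%N -> T t -> u i t != 0)
    (ratio : forall i t, (2 <= i <= d)%N -> T t ->
       r i.-1 t / r i t = u i.-1 t / u i t)
    (Lax : forall t, T t ->
       derive1 (Lmx d r s) t
       = Mmx d u t *m Lmx d r s t - Lmx d r s t *m Mmx d u t)
    (lam : 'I_d.+1 -> R) (lam_inj : injective lam)
    (lam_zero : forall t, T t -> forall j, root (zpoly d r s t) (lam j)) :
  forall t, T t ->
  let L := map_mx (real_complex R) (Lmx d r s t) in
  let Q := Qmx r s lam t in
  let w := wgt r s lam t in
  let tx := xtilde_mon (map_mx (real_complex R) Q) in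
  let U := \matrix_(i < d.+1, j < d) (Q (lift ord0 j) i / Q ord0 i)%:C in
  [/\ (* the tx rho, |rho| = N, form a basis of the space of homogeneous
         polynomials of degree N *)
      (forall rho, mdeg rho = N -> tx rho \is @ishomog1 d.+1 R[i] N mdeg)
      /\ basis_of fullv
           [seq indhomog N (tx (val rho))
             | rho : bmultinom d.+1 N.+1 in [pred rho | mdeg (val rho) == N]],
      forall rho, mdeg rho = N ->
        tx rho =
          (\prod_(i < d.+1) w i `^ ((rho i)%:R / 2))%:C
          *: \sum_(sigma : bmultinom d.+1 N.+1 | mdeg sigma == N)
               (multinomial R[i] sigma
                * krawtchouk N U (mnm_tail sigma) (mnm_tail rho))
               *: mpolyX R[i] sigma,
      forall i j, U i j = ((ppoly r s t j.+1).[lam i])%:C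
    & forall rho, mdeg rho = N ->
        glact L (tx rho) = (\sum_(i < d.+1) lam i * (rho i)%:R)%:C *: tx rho].
Proof.
move=> t Tt L Q w tx U.
have r_neq0 i : (1 <= i <= d)%N -> r i t != 0.
  by move=> id; rewrite gt_eqF ?r_gt0.
have Q0 := Qmx_row0_neq0 r s t lam.
have orth := Qmx_orthogonal d_gt0 r_neq0 (lam_zero t Tt) lam_inj.
have eig := Lmx_Qmx d_gt0 r_neq0 (lam_zero t Tt).
split.
- split=> [rho rhoN|]; first exact: (xtilde_mon_homog _ rhoN).
  (* Orthogonality over the reals supplies the inverse over the complex numbers. *)
  apply: (@xtilde_mon_basis _ _ _ _ (map_mx (real_complex R) Q^T)).
  by rewrite -map_mxM orth map_mx1.
- move=> rho rhoN; rewrite -krawtchouk_gfE // /tx xtilde_mon_krawtchouk_gf.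
    congr (_ *: _).
      rewrite rmorph_prod; apply: eq_bigr => i _.
      by rewrite mxE -rmorphXn /= Qmx_row0 sqrtrX_powR ?wgt_gt0.
    congr krawtchouk_gf; apply/matrixP => i j.
    by rewrite !mxE -fmorph_div.
  by move=> i; rewrite mxE fmorph_eq0.
- by move=> i j; rewrite mxE Qmx_ratio.
- move=> rho _.
  (* The relation $LQ = QD$ is carried from the reals to the complex numbers entrywise. *)
  rewrite (glact_xtilde_mon (lam := map_mx (real_complex R) (\row_j lam j))).
    rewrite rmorph_sum; congr (_ *: _); apply: eq_bigr => i _.
    by rewrite !mxE rmorphM /= rmorph_nat.
  by rewrite -map_mxM eig map_mxM map_diag_mx.
Qed.
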